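(* Let $a>1$ be an integer with $t(a)=t(1)=1$. Then either $a=2$ (and the sequence is $(x_n^{(2)})$), or the sequence $(x_n^{(a)})$ essentially coincides with $(x_n^{(4)})$, i.e. there is $n_0$ such that $x_n^{(a)}=x_n^{(4)}$ for all $n\ge n_0$.
   Context: For a nonnegative integer $m$, $t(m)\in\{0,1\}$ is the parity of the number of ones in the binary expansion of $m$ (Thue–Morse sequence). For an integer $a>1$ with $t(a)=t(1)$, define $x_1^{(a)}=a$ and, for $n\ge2$, $x_n^{(a)}$ is the smallest integer $y>x_{n-1}^{(a)}$ with $t(y)=t(n)$. (E.g. $x^{(4)}$ begins $4,7,9,11,12,15,16,\dots$ and $x^{(2)}$ begins $2,4,5,7,9,\dots$.) *)

(* Defs.v *)
From mathcomp Require Import all_boot.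

Set Implicit Arguments.
Unset Strict Implicit.
Unset Printing Implicit Defensive.

(* The binary digit of [m] of weight [2 ^ i] is [odd (m %/ 2 ^ i)]; since
   [m < 2 ^ m], the digits of index at least [m] are all zero. *)
Definition num_ones (m : nat) : nat := \sum_(i < m) odd (m %/ 2 ^ i).

Definition t (m : nat) : nat := num_ones m %% 2.

Lemma num_ones_widen m N : m < 2 ^ N ->
  \sum_(i < N) odd (m %/ 2 ^ i) = num_ones m.
Proof.
have widen p q : p <= q -> m < 2 ^ p ->
    \sum_(i < q) odd (m %/ 2 ^ i) = \sum_(i < p) odd (m %/ 2 ^ i) :> nat.
  move=> le_pq lt_m.
  rewrite -!(big_mkord xpredT (fun i => nat_of_bool (odd (m %/ 2 ^ i)))).
  rewrite (@big_cat_nat _ _ _ p) //= [X in _ + X]big_nat_cond [X in _ + X]big1 ?addn0 //.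
  move=> i /andP[/andP[le_pi _] _]; rewrite divn_small //.
  by apply: leq_trans lt_m _; rewrite leq_exp2l.
move=> lt_m; case: (leqP m N) => [le_mN | /ltnW le_Nm].
  exact: (widen _ _ le_mN (ltn_expl m (ltnSn 1))).
exact: (esym (widen _ _ le_Nm lt_m)).
Qed.

Lemma num_ones_rec m : num_ones m = odd m + num_ones m./2.
Proof.
have lt1 : m < 2 ^ m.+1 := ltnW (ltn_expl m.+1 (ltnSn 1)).
have lt2 : m./2 < 2 ^ m.
  apply: leq_ltn_trans (ltn_expl m (ltnSn 1)).
  by rewrite leq_half_double -addnn leqW ?leq_addr.
rewrite -(num_ones_widen lt1) -(num_ones_widen lt2) big_ord_recl expn0 divn1.
by congr (_ + _); apply: eq_bigr => i _; rewrite expnS divnMA divn2.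
Qed.

Lemma exists_gt_t (n y : nat) : exists z, (y < z) && (t z == t n).
Proof.
have lt_y : y < y.+1.*2 by rewrite -addnn ltn_addl.
have t0 : t y.+1.*2 = t y.+1 by rewrite /t num_ones_rec odd_double doubleK.
have t1 : t y.+1.*2.+1 = (t y.+1).+1 %% 2.
  rewrite /t num_ones_rec oddS odd_double (half_bit_double _ true) /=.
  by rewrite -[in RHS]addn1 modnDml addnC.
have lt2 k : t k < 2 by rewrite ltn_mod.
have [e | ne] := eqVneq (t y.+1) (t n).
  by exists y.+1.*2; rewrite lt_y t0 e eqxx.
exists y.+1.*2.+1; rewrite ltnW //= t1.
by move: (lt2 y.+1) (lt2 n) ne; case: (t _) => [|[|]] //; case: (t _) => [|[|]].
Qed.

(* [xseq a n] is x_n^(a) for [n >= 1]; the value [xseq a 0 = a] is junk. *)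
Fixpoint xseq (a n : nat) : nat :=
  match n with
  | 0 | 1 => a
  | n'.+1 => ex_minn (exists_gt_t n (xseq a n'))
  end.

(* Main.v *)
Require Import Defs.
From mathcomp Require Import all_boot zify.

(** Exactly one of [2p] and [2p+1] has a given Thue-Morse value, so [x_n] is
    determined by [n] and [p_n = x_n./2].  From [n] to [n+1], [p_n] increases
    by one, unless [t p_n = t n <> t (n+1)], in which case it does not move.
    Hence the gap [p_n - n] never increases, and it cannot drop from [1] to [0]
    because [t (n+1) = t n <> t (n+1)] is absurd.  For every [c >= 2] there are
    arbitrarily large [n] with [t (n+c) = t n <> t (n+1)], so the gap cannot
    remain equal to [c].  If [a >= 4], it starts at [1] or above and so it ends
    up equal to [1], whatever [a] is; and [a = 3] is excluded by [t 3 = 0]. *)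

Definition thue_morse (m : nat) : bool := odd (num_ones m).

Lemma eq_t m n : (t m == t n) = (thue_morse m == thue_morse n).
Proof. by rewrite /t !modn2 /thue_morse; do 2 case: odd. Qed.

Lemma thue_morse_half m : thue_morse m = odd m (+) thue_morse m./2.
Proof. by rewrite /thue_morse num_ones_rec oddD oddb. Qed.

Lemma thue_morse_doubleD m k :
  thue_morse (m.*2 + k) = odd k (+) thue_morse (m + k./2).
Proof. by rewrite thue_morse_half oddD halfD odd_double doubleK. Qed.

Lemma thue_morse_double m : thue_morse m.*2 = thue_morse m.
Proof. by rewrite -[m.*2]addn0 thue_morse_doubleD addn0. Qed.

Lemma thue_morse_doubleS m : thue_morse m.*2.+1 = ~~ thue_morse m.
Proof. by rewrite -addn1 thue_morse_doubleD addn0. Qed.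

Lemma thue_morse_succ_unbounded (b : bool) N :
  exists2 m, N <= m & thue_morse m.+1 = b (+) thue_morse m.
Proof.
case: b.
  exists N.*2; first by lia.
  by rewrite thue_morse_doubleS thue_morse_double.
exists N.*2.*2.+1; first by lia.
by rewrite -doubleS thue_morse_double !thue_morse_doubleS thue_morse_double.
Qed.

Lemma thue_morse_shift_unbounded k (b : bool) N : 0 < k ->
  exists2 m, N <= m & thue_morse (m + k) = b (+) thue_morse m.
Proof.
elim/ltn_ind: k b => k IHk b k_gt0.
have [k_gt1 | k_le1] := ltnP 1 k; last first.
  have -> : k = 1 by lia.
  by have [m] := thue_morse_succ_unbounded b N; exists m; rewrite ?addn1.
have [||m le_Nm tm] := IHk k./2 _ (odd k (+) b); [lia | lia |].
exists m.*2; first by lia.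
by rewrite thue_morse_doubleD tm thue_morse_double !addbA addbb.
Qed.

Definition stalls (n p : nat) : bool :=
  (thue_morse p == thue_morse n) && (thue_morse n.+1 != thue_morse n).

Lemma stalls_succ n : stalls n n.+1 = false.
Proof. by rewrite /stalls andbN. Qed.

Lemma stalls_unbounded c N : 1 < c -> exists2 n, N <= n & stalls n (n + c).
Proof.
move=> c_gt1; have half_c_gt0 : 0 < c./2 by lia.
have [m le_Nm tm] := thue_morse_shift_unbounded c./2 (odd c) N half_c_gt0.
exists m.*2; first by lia.
rewrite /stalls thue_morse_doubleD tm addbA addbb thue_morse_doubleS.
by rewrite thue_morse_double eqxx; case: thue_morse.
Qed.

Section StallingSequence.

Variable p : nat -> nat.
Hypothesis pS : forall n, 0 < n -> p n.+1 = p n + ~~ stalls n (p n).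

Lemma stalling_gap_le c m n : 0 < m <= n -> p m <= m + c -> p n <= n + c.
Proof.
case/andP=> m_gt0 /subnK <- le_pm; elim: (n - m) => // k IHk.
by rewrite addSn pS; [lia | exact: ltn_addl].
Qed.

Lemma stalling_gap_gt0 m n : 0 < m <= n -> m < p m -> n < p n.
Proof.
case/andP=> m_gt0 /subnK <- lt_pm; elim: (n - m) => // k IHk.
rewrite addSn pS; last exact: ltn_addl.
have [eq_p | ne_p] := eqVneq (p (k + m)) (k + m).+1; last by lia.
by rewrite eq_p stalls_succ addn1.
Qed.

Lemma stalling_gap_decr c m : 1 < c -> 0 < m -> p m <= m + c ->
  exists2 n, 0 < n & p n < n + c.
Proof.
move=> c_gt1 m_gt0 le_pm.
have [n le_mn stalls_n] := stalls_unbounded c m c_gt1.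
have n_gt0 : 0 < n by lia.
have le_pn : p n <= n + c by apply: stalling_gap_le le_pm; rewrite m_gt0.
have [eq_pn | ne_pn] := eqVneq (p n) (n + c); last by exists n; lia.
by exists n.+1 => //; rewrite pS // eq_pn stalls_n; lia.
Qed.

Lemma stalling_gap_le1 : exists2 n, 0 < n & p n <= n + 1.
Proof.
have descend c m : 0 < m -> p m <= m + c.+1 ->
    exists2 n, 0 < n & p n <= n + 1.
  elim: c m => [|c IHc] m m_gt0 le_pm; first by exists m.
  have [n n_gt0 lt_pn] := stalling_gap_decr c.+2 m isT m_gt0 le_pm.
  by apply: (IHc n) => //; lia.
by apply: (descend (p 1) 1) => //; lia.
Qed.

Lemma stalling_gap_eventually1 m : 0 < m -> m < p m ->
  exists2 n0, 0 < n0 & forall n, n0 <= n -> p n = n.+1.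
Proof.
move=> m_gt0 lt_pm; have [k k_gt0 le_pk] := stalling_gap_le1.
exists (maxn k m) => [|n]; first by rewrite leq_max k_gt0.
rewrite geq_max => /andP[le_kn le_mn].
apply/eqP; rewrite eqn_leq -{1}[n.+1]addn1.
rewrite (stalling_gap_le 1 k) ?k_gt0 //=.
by apply: (stalling_gap_gt0 m); rewrite ?m_gt0.
Qed.

End StallingSequence.

Definition thue_morse_child (b : bool) (p : nat) : nat :=
  (b (+) thue_morse p) + p.*2.

Lemma thue_morse_childK b p : thue_morse (thue_morse_child b p) = b.
Proof.
rewrite thue_morse_half half_bit_double oddD odd_double addbF oddb.
by rewrite -addbA addbb addbF.
Qed.

Lemma thue_morse_child_half m : thue_morse_child (thue_morse m) m./2 = m.
Proof.
by rewrite /thue_morse_child thue_morse_half -addbA addbb addbF odd_double_half.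
Qed.

Lemma leq_thue_morse_child b : {mono thue_morse_child b : p q / p <= q}.
Proof.
apply: leq_mono => p q; rewrite /thue_morse_child.
by do 2 case: (_ (+) _); lia.
Qed.

Lemma half_least_gt b y z :
    y < z -> thue_morse z = b ->
    (forall w, y < w -> thue_morse w = b -> z <= w) ->
  z./2 = y./2 + (thue_morse_child b y./2 <= y).
Proof.
move=> lt_yz tz z_least; have zE := thue_morse_child_half z; rewrite tz in zE.
have half_z_le q : y < thue_morse_child b q -> z./2 <= q.
  move=> lt_yq; rewrite -(leq_thue_morse_child b) zE.
  by apply: z_least; rewrite ?thue_morse_childK.
apply/eqP; case: leqP => [le_child | lt_child]; rewrite eqn_leq.
  rewrite addn1 half_z_le; last by rewrite /thue_morse_child; lia.
  rewrite -(leqW_mono (leq_thue_morse_child b)) zE.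
  exact: leq_ltn_trans lt_yz.
by rewrite addn0 half_z_le // half_leq // ltnW.
Qed.

Lemma leq_child_stalls n p :
  (thue_morse_child (thue_morse n.+1) p <= thue_morse_child (thue_morse n) p)
    = ~~ stalls n p.
Proof.
rewrite /thue_morse_child /stalls leq_add2r.
by case: (thue_morse n.+1); case: (thue_morse n); case: (thue_morse p).
Qed.

Section Xseq.

Variable a : nat.
Hypothesis ta : t a = t 1.

Lemma thue_morse_xseq n : 0 < n -> thue_morse (xseq a n) = thue_morse n.
Proof.
case: n => [|[_|n _]] //; first by apply/eqP; rewrite -eq_t ta.
by rewrite /=; case: ex_minnP => z /andP[_]; rewrite eq_t => /eqP.
Qed.

Lemma xseq_child n : 0 < n ->
  xseq a n = thue_morse_child (thue_morse n) (xseq a n)./2.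
Proof. by move=> n_gt0; rewrite -thue_morse_xseq // thue_morse_child_half. Qed.

Lemma half_xseqS n : 0 < n ->
  (xseq a n.+1)./2 = (xseq a n)./2 + ~~ stalls n (xseq a n)./2.
Proof.
move=> n_gt0; rewrite -leq_child_stalls -xseq_child //.
case: n n_gt0 => // n _; rewrite [xseq a n.+2]/=.
case: ex_minnP => z /andP[lt_z]; rewrite eq_t => /eqP tz z_least.
by apply: half_least_gt => // w lt_w tw; rewrite z_least // lt_w eq_t tw eqxx.
Qed.

Lemma xseq_eventually_child : 3 < a ->
  exists m, forall n, m <= n -> xseq a n = thue_morse_child (thue_morse n) n.+1.
Proof.
move=> a_gt3.
have [|m m_gt0 half_x] := stalling_gap_eventually1 _ half_xseqS 1 isT.
  by rewrite /=; lia.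
by exists m => n le_mn; rewrite xseq_child ?half_x // (leq_trans m_gt0).
Qed.

End Xseq.

Theorem theorem3 (a : nat) (a_gt1 : 1 < a) (ta : t a = t 1) :
  a = 2 \/ exists n0 : nat, forall n : nat, n0 <= n -> xseq a n = xseq 4 n.
Proof.
have t4 : t 4 = t 1.
  by apply/eqP; rewrite eq_t (thue_morse_double 2) (thue_morse_double 1).
have a_neq3 : a != 3.
  apply: contra_eq_neq ta => ->.
  by rewrite eq_t (thue_morse_doubleS 1); case: thue_morse.
have [-> | a_neq2] := eqVneq a 2; [by left | right].
have [|m xaE] := xseq_eventually_child a ta; first by lia.
have [m4 x4E] := xseq_eventually_child 4 t4 isT.
exists (maxn m m4) => n; rewrite geq_max => /andP[le_mn le_m4n].
by rewrite xaE ?x4E.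
Qed.
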